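(* Work in max-plus algebra $\mathbb{R}_{\max,+}$ with $\mathbb{X}=\mathbb{R}\cup\{-\infty\}$, and let $n\geq1$. Let $\bm{B},\bm{D}\in\mathbb{X}^{n\times n}$ be matrices and $\bm{C}\in\mathbb{X}^{n\times n}$ a column-regular matrix such that the matrix $\bm{R}=\bm{B}\oplus\bm{D}\bm{C}$ satisfies $\mathrm{Tr}(\bm{R})\leq\mathbb{1}$. Let $\bm{g}\in\mathbb{X}^{n}$ be a vector and $\bm{f},\bm{h}\in\mathbb{X}^{n}$ regular vectors such that the row vector $\bm{s}^{-}=\bm{f}^{-}\bm{C}\oplus\bm{h}^{-}$ satisfies $\bm{s}^{-}\bm{R}^{\ast}\bm{g}\leq\mathbb{1}$. Consider the problem of minimizing $$\bm{x}^{-}\bm{1}\bm{1}^{T}\bm{y}$$ over vectors $\bm{x},\bm{y}\in\mathbb{X}^{n}$ with $\bm{x}$ regular, subject to $$\bm{B}\bm{x}\leq\bm{x},\quad \bm{C}\bm{x}=\bm{y},\quad \bm{D}\bm{y}\leq\bm{x},\quad \bm{g}\leq\bm{x}\leq\bm{h},\quad \bm{y}\leq\bm{f}.$$ Then the minimum value of the objective function in this problem is equal to $$\theta=\bigoplus_{0\leq i+j\leq n-2}\|\bm{s}^{-}\bm{R}^{i}\|\,\|\bm{C}\bm{R}^{j}\bm{g}\|\oplus\|\bm{C}\bm{R}^{\ast}\|,$$ and all regular solutions are given in the parametric form $$\bm{x}=\bm{G}\bm{u},\qquad \bm{y}=\bm{C}\bm{G}\bm{u},\qquad \bm{G}=\bigoplus_{0\leq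 i+j\leq n-2}\theta^{-1}\bm{R}^{i}\bm{1}\bm{1}^{T}\bm{C}\bm{R}^{j}\oplus\bm{R}^{\ast},$$ where $\bm{u}\in\mathbb{X}^{n}$, $\bm{u}\neq\bm{0}$, is a vector of parameters satisfying $$\bm{g}\leq\bm{u}\leq(\bm{s}^{-}\bm{G})^{-}.$$ That is, a pair $(\bm{x},\bm{y})$ with $\bm{x}$ regular is feasible and attains the minimum $\theta$ if and only if $\bm{x}=\bm{G}\bm{u}$ and $\bm{y}=\bm{C}\bm{G}\bm{u}$ for some such $\bm{u}$.
   Context: Max-plus algebra $\mathbb{R}_{\max,+}$: the set $\mathbb{X}=\mathbb{R}\cup\{-\infty\}$ with $\oplus=\max$, $\otimes=+$ (sign omitted), zero $\mathbb{0}=-\infty$, one $\mathbb{1}=0$, inverse $x^{-1}=-x$ for $x\neq\mathbb{0}$, and the usual linear order. Matrix and vector operations are the usual ones with $+,\times$ replaced by $\oplus,\otimes$; inequalities between vectors are entrywise. $\mathbb{X}^{n}$ denotes column vectors. $\bm{0}$ is the vector with all entries $\mathbb{0}$; a vector is regular if none of its entries is $\mathbb{0}$; a matrix is column-regular if no column consists entirely of $\mathbb{0}$. For a nonzero column vector $\bm{x}=(x_i)$, $\bm{x}^{-}$ is the row vector with entries $x_i^{-1}$ if $x_i\neq\mathbb{0}$ and $\mathbb{0}$ otherwise; for a nonzero row vector, $(\cdot)^{-}$ is defined in the same way and gives a column vector. $\bm{I}$ is the identity matrix ($\mathbb{1}$ on the diagonal, $\mathbb{0}$ elsewhere), $\bm{A}^{0}=\bm{I}$,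 $\bm{A}^{p}=\bm{A}^{p-1}\bm{A}$. For $\bm{A}=(a_{ij})\in\mathbb{X}^{n\times n}$: $\mathrm{tr}\,\bm{A}=\bigoplus_{k=1}^{n}a_{kk}$, $\mathrm{Tr}(\bm{A})=\bigoplus_{k=1}^{n}\mathrm{tr}\,\bm{A}^{k}$, and $\bm{A}^{\ast}=\bigoplus_{k=0}^{n-1}\bm{A}^{k}$ (Kleene star, used when $\mathrm{Tr}(\bm{A})\leq\mathbb{1}$). $\bm{1}=(\mathbb{1},\ldots,\mathbb{1})^{T}\in\mathbb{X}^{n}$. For a (row or column) vector or a matrix, $\|\cdot\|$ is the $\oplus$-sum (maximum) of all its entries: $\|\bm{x}\|=\bm{1}^{T}\bm{x}$ for a column vector, $\|\bm{z}\|=\bm{z}\bm{1}$ for a row vector, $\|\bm{A}\|=\bm{1}^{T}\bm{A}\bm{1}$. In sums over $0\leq i+j\leq n-2$, the indices $i,j$ are nonnegative integers; an empty sum is zero. Scheduling meaning: $x_i,y_i$ are the start and finish times of activity $i$, and the objective is the project makespan $\max_i y_i-\min_i x_i$ in ordinary notation. *)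

(* Defs.v *)
From HB Require Import structures.
From mathcomp Require Import all_boot all_order all_algebra.
From mathcomp Require Import reals.
Set Implicit Arguments.
Unset Strict Implicit.
Unset Printing Implicit Defensive.
Import Order.TTheory GRing.Theory Num.Theory.
Local Open Scope ring_scope.

(* R extended with -oo, represented by [None]. The semiring instance below
   makes [+], [*], [0], [1] (hence [*m], [^+], [\tr], [\sum]) on [maxplus R]
   denote max, ordinary addition, -oo and the real number 0. *)
Definition maxplus (R : realDomainType) : Type := option R.

HB.instance Definition _ (R : realDomainType) := Choice.on (maxplus R).

Definition mpadd (R : realDomainType) (x y : maxplus R) : maxplus R :=
  match x, y with
  | Some a, Some b => Some (Num.max a b)
  | Some _, None => x
  | None, _ => y
  end.

Definition mpmul (R : realDomainType) (x y : maxplus R) : maxplus R :=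
  match x, y with
  | Some a, Some b => Some (a + b)
  | _, _ => None
  end.

Lemma mpaddA (R : realDomainType) : associative (@mpadd R).
Proof. by case=> [a|] [b|] [c|] //=; rewrite maxA. Qed.

Lemma mpaddC (R : realDomainType) : commutative (@mpadd R).
Proof. by case=> [a|] [b|] //=; rewrite maxC. Qed.

Lemma mpadd0 (R : realDomainType) : left_id None (@mpadd R).
Proof. by case. Qed.

HB.instance Definition _ (R : realDomainType) :=
  GRing.isNmodule.Build (maxplus R) (@mpaddA R) (@mpaddC R) (@mpadd0 R).

Lemma mpmulA (R : realDomainType) : associative (@mpmul R).
Proof. by case=> [a|] [b|] [c|] //=; rewrite addrA. Qed.

Lemma mpmulC (R : realDomainType) : commutative (@mpmul R).
Proof. by case=> [a|] [b|] //=; rewrite addrC. Qed.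

Lemma mpmul1 (R : realDomainType) : left_id (Some 0) (@mpmul R).
Proof. by case=> [a|] //=; rewrite add0r. Qed.

Lemma mpmulDl (R : realDomainType) : left_distributive (@mpmul R) (@mpadd R).
Proof. by case=> [a|] [b|] [c|] //=; rewrite addr_maxl. Qed.

Lemma mpmul0 (R : realDomainType) : left_zero None (@mpmul R).
Proof. by []. Qed.

Lemma mpone_neq0 (R : realDomainType) : (Some 0 : maxplus R) != None.
Proof. by []. Qed.

HB.instance Definition _ (R : realDomainType) :=
  GRing.Nmodule_isComNzSemiRing.Build (maxplus R) (@mpmulA R) (@mpmulC R)
    (@mpmul1 R) (@mpmulDl R) (@mpmul0 R) (@mpone_neq0 R).

Definition mple (R : realDomainType) (x y : maxplus R) : bool :=
  match x, y with
  | Some a, Some b => a <= b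
  | Some _, None => false
  | None, _ => true
  end.

Lemma mple_refl (R : realDomainType) : reflexive (@mple R).
Proof. by case=> [a|] /=. Qed.

Lemma mple_anti (R : realDomainType) : antisymmetric (@mple R).
Proof. by case=> [a|] [b|] //= /le_anti ->. Qed.

Lemma mple_trans (R : realDomainType) : transitive (@mple R).
Proof. by case=> [a|] [b|] [c|] //=; apply: le_trans. Qed.

HB.instance Definition _ (R : realDomainType) :=
  Order.Le_isPOrder.Build ring_display (maxplus R)
    (@mple_refl R) (@mple_anti R) (@mple_trans R).

Lemma mple_total (R : realDomainType) : total (@mple R).
Proof. by case=> [a|] [b|] //=; apply: le_total. Qed.

HB.instance Definition _ (R : realDomainType) :=
  Order.POrder_isTotal.Build ring_display (maxplus R) (@mple_total R).

(* Only meaningful for [x != 0]; the value at -oo is the one needed in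
   [mpconj]. *)
Definition mpinv (R : realDomainType) (x : maxplus R) : maxplus R :=
  if x is Some a then Some (- a) else None.

(* The conjugate transpose x |-> x^-, of column as well as of row vectors. *)
Definition mpconj (R : realDomainType) (m n : nat) (A : 'M[maxplus R]_(m, n)) :
  'M[maxplus R]_(n, m) := \matrix_(i, j) mpinv (A j i).

Definition mxle (R : realDomainType) (m n : nat) (A B : 'M[maxplus R]_(m, n)) :
  Prop := forall i j, A i j <= B i j.

Definition regular (R : realDomainType) (n : nat) (x : 'cV[maxplus R]_n) :
  Prop := forall i, x i ord0 != 0.

Definition column_regular (R : realDomainType) (m n : nat)
  (A : 'M[maxplus R]_(m, n)) : Prop := forall j, exists i, A i j != 0.

Definition ones (R : realDomainType) (n : nat) : 'cV[maxplus R]_n := const_mx 1.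

Definition mpnorm (R : realDomainType) (m n : nat) (A : 'M[maxplus R]_(m, n)) :
  maxplus R := \sum_i \sum_j A i j.

Definition mpTr (R : realDomainType) (n : nat) (A : 'M[maxplus R]_n) :
  maxplus R := \sum_(1 <= k < n.+1) \tr (A ^+ k).

Definition kleene (R : realDomainType) (n : nat) (A : 'M[maxplus R]_n) :
  'M[maxplus R]_n := \sum_(0 <= k < n) A ^+ k.

Definition makespan (R : realDomainType) (n : nat) (x y : 'cV[maxplus R]_n) :
  maxplus R :=
  (mpconj x *m ones R n *m (ones R n)^T *m y) ord0 ord0.

Definition feasible (R : realDomainType) (n : nat) (B C D : 'M[maxplus R]_n)
    (f g h x y : 'cV[maxplus R]_n) : Prop :=
  [/\ regular x,
      [/\ mxle (B *m x) x, C *m x = y & mxle (D *m y) x],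
      mxle g x /\ mxle x h
    & mxle y f].

(* The range 0 <= i + j <= n - 2 is written [i + j + 2 <= n], so that it is
   empty for n = 1 (on nat, 1 - 2 = 0). [M] stands for the matrix
   B (+) DC, and [s] for the row vector s^-, not for its conjugate. *)
Definition theta (R : realDomainType) (n : nat) (C M : 'M[maxplus R]_n)
    (s : 'rV[maxplus R]_n) (g : 'cV[maxplus R]_n) : maxplus R :=
  (\sum_(i < n) \sum_(j < n | (i + j + 2 <= n)%N)
     mpnorm (s *m M ^+ i) * mpnorm (C *m M ^+ j *m g))
  + mpnorm (C *m kleene M).

Definition solmx (R : realDomainType) (n : nat) (C M : 'M[maxplus R]_n)
    (t : maxplus R) : 'M[maxplus R]_n :=
  (\sum_(i < n) \sum_(j < n | (i + j + 2 <= n)%N)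
     mpinv t *: (M ^+ i *m ones R n *m (ones R n)^T *m C *m M ^+ j))
  + kleene M.

(* Main.v *)
(** Write [M = B (+) DC], [c = 1^T C] and [P = t^-1 1 c]. Eliminating [y = Cx],
    a regular [x] is feasible iff [M x <= x], [g <= x] and [s x <= 1], and its
    makespan is at most [t] iff [P x <= x]. For such [x] every term of
    [G = solmx C M t] maps [x] below itself, so [x = G x]. Conversely
    [c M^k 1 <= t] makes [P M^k P <= P], so [G] is the Kleene star of
    [Q = P (+) M] and [Tr Q <= 1]; hence [Q G <= G] and each [G u] is a
    solution. That no feasible [x] beats [t] follows by applying the rows
    [s M^i] and [c M^k] to [(c x) 1 <= v x], where [v] is the makespan. *)
Require Import Defs.
From mathcomp Require Import all_boot all_order all_algebra.
From mathcomp Require Import reals.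
Import Order.TTheory GRing.Theory Num.Theory.
Local Open Scope ring_scope.

Set Implicit Arguments.
Unset Strict Implicit.
Unset Printing Implicit Defensive.

Section Scalars.
Variable R : realDomainType.
Implicit Types x y z : maxplus R.

Lemma mp_neq0_le x y : x <= y -> x != 0 -> y != 0.
Proof. by case: x y => [x|] [y|]. Qed.

Lemma mp_leD x y z : (x + y <= z) = (x <= z) && (y <= z).
Proof.
case: x y z => [x|] [y|] [z|] //=; rewrite ?andbT ?andbF //.
by rewrite /Order.le /= ge_max.
Qed.

Lemma mp_leDl x y : x <= x + y.
Proof. by have := lexx (x + y); rewrite {1}mp_leD => /andP[]. Qed.

Lemma mp_addE x y : x + y = x \/ x + y = y.
Proof.
case: x y => [x|] [y|]; [|by left|by right|by left].
by have [le_xy|le_yx] := leP x y; [right|left]; congr Some;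
  [exact/max_r | exact/max_l/ltW].
Qed.

Lemma mp_mul_neq0 x y : x != 0 -> y != 0 -> x * y != 0.
Proof. by case: x y => [x|] [y|]. Qed.

Lemma mp_leM x y x' y' : x <= x' -> y <= y' -> x * y <= x' * y'.
Proof.
case: x x' y y' => [x|] [x'|] [y|] [y'|] //; exact: lerD.
Qed.

Lemma mp_leM2r z x y : z != 0 -> (x * z <= y * z) = (x <= y).
Proof. by case: z x y => [z|] [x|] [y|] //= _; apply: lerD2r. Qed.

Lemma mpinv_eq0 x : (mpinv x == 0) = (x == 0).
Proof. by case: x. Qed.

Lemma mpinvK : involutive (@mpinv R).
Proof. by case=> [x|] //=; rewrite opprK. Qed.

Lemma mpmulV x : x != 0 -> mpinv x * x = 1.
Proof. by case: x => [x|] //= _; congr Some; rewrite addNr. Qed.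

Lemma mpinv_mul_le x y z : x != 0 -> (mpinv x * y <= z) = (y <= z * x).
Proof.
by move=> x0; rewrite -(mp_leM2r _ _ x0) mulrAC mpmulV // mul1r.
Qed.

Lemma mp_sum_le (I : Type) (r : seq I) (P : pred I) (F : I -> maxplus R) z :
  (forall i, P i -> F i <= z) -> \sum_(i <- r | P i) F i <= z.
Proof.
by move=> leFz; elim/big_ind: _ => // [x y xz yz]; rewrite mp_leD xz.
Qed.

Lemma mp_le_sum (I : finType) (P : pred I) (F : I -> maxplus R) i :
  P i -> F i <= \sum_(j | P j) F j.
Proof.
by move=> Pi; rewrite (bigD1 i) //=; apply: mp_leDl.
Qed.

Lemma mp_le_sum_nat m n (F : nat -> maxplus R) k :
  (m <= k < n)%N -> F k <= \sum_(m <= j < n) F j.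
Proof.
move=> /andP[mk kn]; rewrite (big_cat_nat mk (ltnW kn)) /= (big_ltn kn).
by rewrite addrCA; apply: mp_leDl.
Qed.

Lemma mp_sum_attained (I : Type) (r : seq I) (P : pred I) (F : I -> maxplus R) :
  \sum_(i <- r | P i) F i != 0 -> exists i, \sum_(i <- r | P i) F i = F i.
Proof.
elim/big_rec: _ => [|i x Pi IH]; first by rewrite eqxx.
by case: (mp_addE (F i) x) => -> // _; exists i.
Qed.

End Scalars.

Section Matrices.
Variable R : realDomainType.
Local Notation X := (maxplus R).

Lemma mxle_refl m n (A : 'M[X]_(m, n)) : mxle A A.
Proof. by move=> i j. Qed.

Lemma mxle_trans m n (B A C : 'M[X]_(m, n)) : mxle A B -> mxle B C ->
  mxle A C.
Proof. by move=> leAB leBC i j; apply: le_trans (leBC i j). Qed.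

Lemma mxle_anti m n (A B : 'M[X]_(m, n)) : mxle A B -> mxle B A -> A = B.
Proof.
by move=> leAB leBA; apply/matrixP => i j; apply/le_anti; rewrite leAB leBA.
Qed.

Lemma mxleDP m n (A B C : 'M[X]_(m, n)) :
  mxle (A + B) C <-> mxle A C /\ mxle B C.
Proof.
split=> [ABC|[leAC leBC] i j]; last by rewrite mxE mp_leD leAC leBC.
by split=> i j; have := ABC i j; rewrite mxE mp_leD => /andP[].
Qed.

Lemma mxleDl m n (A B : 'M[X]_(m, n)) : mxle A (A + B).
Proof. by have /mxleDP[] := mxle_refl (A + B). Qed.

Lemma mxleDr m n (A B : 'M[X]_(m, n)) : mxle B (A + B).
Proof. by have /mxleDP[] := mxle_refl (A + B). Qed.

Lemma mxleM m n p (A A' : 'M[X]_(m, n)) (B B' : 'M[X]_(n, p)) :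
  mxle A A' -> mxle B B' -> mxle (A *m B) (A' *m B').
Proof.
move=> AA' BB' i j; rewrite !mxE; apply: mp_sum_le => k _.
apply: le_trans (mp_leM (AA' i k) (BB' k j)) _.
exact: (mp_le_sum (fun k => A' i k * B' k j)).
Qed.

Lemma mxleMl m n p (A : 'M[X]_(m, n)) (B B' : 'M[X]_(n, p)) :
  mxle B B' -> mxle (A *m B) (A *m B').
Proof. exact/mxleM/mxle_refl. Qed.

Lemma mxleMr m n p (B : 'M[X]_(n, p)) (A A' : 'M[X]_(m, n)) :
  mxle A A' -> mxle (A *m B) (A' *m B).
Proof. by move=> AA'; apply: mxleM => //; apply: mxle_refl. Qed.

Lemma mxleZ m n (a : X) (A B : 'M[X]_(m, n)) :
  mxle A B -> mxle (a *: A) (a *: B).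
Proof. by move=> AB i j; rewrite !mxE mp_leM. Qed.

Lemma mxleX n (A B : 'M[X]_n) k : mxle A B -> mxle (A ^+ k) (B ^+ k).
Proof.
move=> AB; elim: k => [|k IHk]; first exact: mxle_refl.
by rewrite !exprS; apply: mxleM.
Qed.

Lemma mxle_sum (I : Type) (r : seq I) (P : pred I) m n
    (F : I -> 'M[X]_(m, n)) Z :
  (forall i, P i -> mxle (F i) Z) -> mxle (\sum_(i <- r | P i) F i) Z.
Proof.
by move=> leFZ a b; rewrite summxE; apply: mp_sum_le => i /leFZ; apply.
Qed.

Lemma mxle_sum_nat m n p q (F : nat -> 'M[X]_(m, n)) k :
  (p <= k < q)%N -> mxle (F k) (\sum_(p <= j < q) F j).
Proof.
by move=> pkq a b; rewrite summxE; apply: (mp_le_sum_nat (fun k => F k a b)).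
Qed.

Lemma mxle_sum2 n (I J : finType) (P : I -> pred J) m
    (F : I -> J -> 'M[X]_(m, n)) i j :
  P i j -> mxle (F i j) (\sum_i \sum_(j | P i j) F i j).
Proof.
move=> Pij a b; rewrite summxE.
apply: le_trans
  (mp_le_sum (fun i => (\sum_(j | P i j) F i j) a b) (i := i) _) => //.
by rewrite summxE; apply: (mp_le_sum (fun j => F i j a b)).
Qed.

Lemma mxle_kleene n (A : 'M[X]_n) k : (k < n)%N -> mxle (A ^+ k) (kleene A).
Proof. by move=> kn; apply: (mxle_sum_nat (fun k => A ^+ k)). Qed.

Lemma mulX_le n p (A : 'M[X]_n) (x : 'M[X]_(n, p)) k :
  mxle (A *m x) x -> mxle (A ^+ k *m x) x.
Proof.
move=> Ax; elim: k => [|k IHk]; first by rewrite expr0 mul1mx; apply: mxle_refl.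
rewrite exprSr -mulmxE -mulmxA; apply: mxle_trans IHk; exact: mxleMl.
Qed.

Lemma le_mxtrace n (A : 'M[X]_n) i : A i i <= \tr A.
Proof. exact: (mp_le_sum (fun i => A i i)). Qed.

Lemma mxtrace_le n (A B : 'M[X]_n) : mxle A B -> \tr A <= \tr B.
Proof.
move=> AB; apply: mp_sum_le => i _; apply: le_trans (AB i i) _.
exact: le_mxtrace.
Qed.

End Matrices.

Section Carre.
Variables (R : realDomainType) (n : nat) (A : 'M[maxplus R]_n).

Fixpoint walk_weight (i : 'I_n) (p : seq 'I_n) : maxplus R :=
  if p is j :: q then A i j * walk_weight j q else 1.

Lemma walk_weight_cat i p q :
  walk_weight i (p ++ q) = walk_weight i p * walk_weight (last i p) q.
Proof. by elim: p i => [|j p IHp] i /=; rewrite ?mul1r // IHp mulrA. Qed.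

Lemma walk_weight_le i p : walk_weight i p <= (A ^+ size p) i (last i p).
Proof.
elim: p i => [|j p IHp] i /=; first by rewrite expr0 mxE eqxx.
rewrite exprS mxE; apply: le_trans (mp_leM (lexx _) (IHp j)) _.
exact: (mp_le_sum (fun k => A i k * (A ^+ size p) k (last j p))).
Qed.

Lemma expmx_walk k i j : (A ^+ k) i j != 0 ->
  exists p, [/\ size p = k, last i p = j & (A ^+ k) i j = walk_weight i p].
Proof.
elim: k i => [|k IHk] i.
  rewrite expr0 mxE; have [->|_ //] := eqVneq i j.
  by exists [::].
rewrite exprS mxE => nz; have [l eq_l] := mp_sum_attained nz.
move: nz; rewrite eq_l => nz.
have /IHk[p [size_p last_p wp]] : (A ^+ k) l j != 0.
  by apply: contraNneq nz => ->; rewrite mulr0.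
by exists (l :: p); rewrite /= size_p wp.
Qed.

Lemma not_uniq_split (T : eqType) (i : T) p : ~~ uniq (i :: p) ->
  exists p1 p2 p3, [/\ p = p1 ++ p2 ++ p3, p2 != [::] &
    last (last i p1) p2 = last i p1].
Proof.
elim: p i => [//|j p IHp] i; rewrite cons_uniq negb_and negbK => /orP[].
  by case/path.splitP=> p1 p2; exists [::], (rcons p1 i), p2;
     rewrite /= last_rcons -size_eq0 size_rcons.
move/IHp => [p1 [p2 [p3 [-> p2N eq_last]]]].
by exists (j :: p1), p2, p3.
Qed.

(* A walk of length n visits some vertex twice; deleting the cycle in between
   does not decrease the weight. *)
Lemma expmx_le_kleene : mpTr A <= 1 -> mxle (A ^+ n) (kleene A).
Proof.
move=> TrA i j; have [-> //|/expmx_walk[p [size_p last_p ->]]] :=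
  eqVneq ((A ^+ n) i j) 0.
have /not_uniq_split[p1 [p2 [p3 [def_p p2N last_p2]]]] : ~~ uniq (i :: p).
  apply/negP => /card_uniqP => card_p.
  by have := max_card (mem (i :: p)); rewrite card_p /= size_p card_ord ltnn.
move: size_p; rewrite def_p !size_cat => size_p.
have p2_gt0 : (0 < size p2)%N by rewrite lt0n size_eq0.
have p2_le : (size p2 <= n)%N by rewrite -[leqRHS]size_p addnCA leq_addr.
set l := last i p1 in last_p2.
have le_p2 : walk_weight l p2 <= 1.
  apply: le_trans (walk_weight_le _ _) _; rewrite last_p2.
  apply: le_trans (le_mxtrace _ _) _.
  apply: le_trans TrA.
  by apply: (mp_le_sum_nat (fun k => \tr (A ^+ k))); rewrite p2_gt0.
rewrite !walk_weight_cat last_p2 -/l.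
apply: (@le_trans _ _ (walk_weight i (p1 ++ p3))).
  by rewrite walk_weight_cat mp_leM // -[leRHS]mul1r mp_leM.
apply: le_trans (walk_weight_le _ _) _.
have -> : last i (p1 ++ p3) = j.
  by rewrite -last_p def_p !last_cat -/l last_p2.
apply: mxle_kleene.
by rewrite size_cat -[ltnRHS]size_p ltn_add2l -[ltnLHS]add0n ltn_add2r.
Qed.

Lemma mul_kleene_le : mpTr A <= 1 -> mxle (A *m kleene A) (kleene A).
Proof.
move=> TrA; rewrite /kleene mulmx_sumr big_nat_cond; apply: mxle_sum => k.
rewrite andbT => /andP[_ kn]; rewrite mulmxE -exprS.
move: kn; rewrite leq_eqVlt => /predU1P[->|]; last exact: mxle_kleene.
exact: expmx_le_kleene.
Qed.

End Carre.

Section RankOnePerturbation.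
Variables (R : realDomainType) (n : nat) (C M : 'M[maxplus R]_n).
Variable t : maxplus R.

Lemma mpnormE m p (A : 'M[maxplus R]_(m, p)) :
  mpnorm A = ((ones R m)^T *m A *m ones R p) 0 0.
Proof.
rewrite /mpnorm mxE exchange_big; apply: eq_bigr => j _ /=.
by rewrite !mxE mulr1; apply: eq_bigr => i _; rewrite !mxE mul1r.
Qed.

Lemma ones1 : ones R 1 = 1%:M.
Proof. by apply/matrixP => i j; rewrite !ord1 !mxE. Qed.

Lemma ones_mulE m p (r : 'rV[maxplus R]_p) i j : (ones R m *m r) i j = r 0 j.
Proof. by rewrite mxE big_ord1 mxE mul1r. Qed.

Definition rank_one : 'M[maxplus R]_n :=
  mpinv t *: (ones R n *m ((ones R n)^T *m C)).

Local Notation P := rank_one.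
Local Notation Q := (rank_one + M).

Lemma solmxE : solmx C M t =
  \sum_(i < n) \sum_(j < n | (i + j + 2 <= n)%N) M ^+ i *m P *m M ^+ j
  + kleene M.
Proof.
congr (_ + _); apply: eq_bigr => i _; apply: eq_bigr => j _.
by rewrite /P -scalemxAr -scalemxAl !mulmxA.
Qed.

Lemma solmx_ge1 : (0 < n)%N -> mxle 1%:M (solmx C M t).
Proof. by move=> n0; apply: mxle_trans (mxle_kleene M n0) _; apply: mxleDr. Qed.

Lemma solmx_mul_le p (x : 'M[maxplus R]_(n, p)) :
  mxle (M *m x) x -> mxle (P *m x) x -> mxle (solmx C M t *m x) x.
Proof.
move=> Mx Px; rewrite solmxE mulmxDl; apply/mxleDP; split; last first.
  by rewrite mulmx_suml; apply: mxle_sum => k _; apply: mulX_le.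
rewrite mulmx_suml; apply: mxle_sum => i _.
rewrite mulmx_suml; apply: mxle_sum => j _; rewrite -!mulmxA.
apply: mxle_trans (mulX_le i Mx); apply: mxleMl.
by apply: mxle_trans Px; apply: mxleMl; apply: mulX_le.
Qed.

Hypothesis t_neq0 : t != 0.
Hypothesis norm_le : forall k, (k < n)%N -> mpnorm (C *m M ^+ k) <= t.

Lemma rank_one_mid k : (k < n)%N -> mxle (P *m M ^+ k *m P) P.
Proof.
move=> /norm_le; rewrite mpnormE mulmxA => le_t.
set o := ones R n in le_t *; set c := o^T *m C.
have le_c : mxle (c *m M ^+ k *m o) t%:M.
  by move=> i j; rewrite !ord1 [leRHS]mxE eqxx.
rewrite /P -/o -/c -scalemxAl -scalemxAl -scalemxAr; apply: mxleZ.
have -> : o *m c *m M ^+ k *m (o *m c) = o *m (c *m M ^+ k *m o) *m c.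
  by rewrite !mulmxA.
apply: mxle_trans (mxleZ _ (mxleMr c (mxleMl o le_c))) _.
rewrite mul_mx_scalar -scalemxAl scalerA mpmulV // scale1r.
exact: mxle_refl.
Qed.

Lemma rank_one_trace i j : (i + j < n)%N -> \tr (M ^+ i *m P *m M ^+ j) <= 1.
Proof.
move=> /norm_le; rewrite mpnormE mulmxA => le_t.
rewrite -mulmxA mxtrace_mulC -mulmxA mulmxE -exprD -mulmxE addnC.
rewrite /P -scalemxAl mxtraceZ -mulmxA mxtrace_mulC mpinv_mul_le // mul1r.
by rewrite /mxtrace big_ord1.
Qed.

Let E k := M ^+ k +
  \sum_(i < n) \sum_(j < n | (i + j < k)%N) M ^+ i *m P *m M ^+ j.

Lemma le_expansion i j k : (i + j < k)%N -> (k <= n)%N ->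
  mxle (M ^+ i *m P *m M ^+ j) (E k).
Proof.
move=> ijk kn; apply: mxle_trans (mxleDr _ _).
have lin : (i < n)%N by rewrite (leq_trans _ kn) ?(leq_ltn_trans _ ijk) ?leq_addr.
have ljn : (j < n)%N by rewrite (leq_trans _ kn) ?(leq_ltn_trans _ ijk) ?leq_addl.
exact: (mxle_sum2 (P := fun (i j : 'I_n) => (i + j < k)%N)
  (fun i j : 'I_n => M ^+ i *m P *m M ^+ j)
  (i := Ordinal lin) (j := Ordinal ljn)).
Qed.

(* Every product with two or more factors [P] is absorbed by one with fewer. *)
Lemma exp_le_expansion k : (k <= n)%N -> mxle (Q ^+ k) (E k).
Proof.
elim: k => [_|k IHk kn]; first exact: mxleDl.
rewrite exprS -mulmxE; apply: mxle_trans (mxleMl _ (IHk (ltnW kn))) _.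
rewrite mulmxDl /E !mulmxDr !mulmx_sumr.
apply/mxleDP; split; apply/mxleDP; split.
- by have := @le_expansion 0 k k.+1; rewrite expr0 mul1mx; apply.
- apply: mxle_sum => i _; rewrite mulmx_sumr; apply: mxle_sum => j ijk.
  rewrite !mulmxA; apply: mxle_trans (mxleMr _ (rank_one_mid (ltn_ord i))) _.
  have := @le_expansion 0 j k.+1; rewrite expr0 mul1mx; apply => //.
  by rewrite add0n ltnS ltnW //; apply: leq_ltn_trans ijk; rewrite leq_addl.
- by rewrite mulmxE -exprS; apply: mxleDl.
- apply: mxle_sum => i _; rewrite mulmx_sumr; apply: mxle_sum => j ijk.
  by have := @le_expansion i.+1 j k.+1; rewrite exprS -mulmxE -!mulmxA; apply.
Qed.

Lemma mpTr_perturb : mpTr M <= 1 -> mpTr Q <= 1.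
Proof.
move=> TrM; rewrite /mpTr big_nat_cond; apply: mp_sum_le => k.
rewrite andbT => k1n; have /andP[_ kn] := k1n.
apply: le_trans (mxtrace_le (exp_le_expansion kn)) _.
rewrite /E raddfD mp_leD; apply/andP; split.
  by apply: le_trans TrM; apply: (mp_le_sum_nat (fun k => \tr (M ^+ k))).
rewrite raddf_sum; apply: mp_sum_le => i _.
rewrite raddf_sum; apply: mp_sum_le => j ijk.
by apply: rank_one_trace; apply: leq_trans ijk _.
Qed.

Lemma solmx_kleene : solmx C M t = kleene Q.
Proof.
apply: mxle_anti; rewrite solmxE.
  apply/mxleDP; split; last first.
    rewrite /kleene big_nat_cond; apply: mxle_sum => k /andP[/andP[_ kn] _].
    by apply: mxle_trans (mxle_kleene _ kn); apply/mxleX/mxleDr.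
  apply: mxle_sum => i _; apply: mxle_sum => j ijn.
  have lt_n : ((i + j).+1 < n)%N by rewrite -addn2.
  apply: mxle_trans (mxle_kleene _ lt_n).
  rewrite -addSn exprD exprSr -!mulmxE; apply: mxleM; last exact/mxleX/mxleDr.
  by apply: mxleM; [exact/mxleX/mxleDr | exact: mxleDl].
rewrite /kleene big_nat_cond; apply: mxle_sum => k /andP[/andP[_ kn] _].
apply: mxle_trans (exp_le_expansion (ltnW kn)) _; apply/mxleDP; split.
  by apply: mxle_trans (mxle_kleene _ kn) _; apply: mxleDr.
apply: mxle_sum => i _; apply: mxle_sum => j ijk.
apply: mxle_trans (mxleDl _ _).
apply: (mxle_sum2 (P := fun (i j : 'I_n) => (i + j + 2 <= n)%N)
  (fun i j : 'I_n => M ^+ i *m P *m M ^+ j)).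
by rewrite addn2; apply: leq_trans kn.
Qed.

Lemma perturb_mul_solmx :
  mpTr M <= 1 -> mxle (Q *m solmx C M t) (solmx C M t).
Proof.
by move=> TrM; rewrite solmx_kleene; apply/mul_kleene_le/mpTr_perturb.
Qed.

End RankOnePerturbation.

Section Problem.
Variables (R : realDomainType) (n : nat).
Variables (B C D : 'M[maxplus R]_n) (f g h : 'cV[maxplus R]_n).
Local Notation M := (B + D *m C).
Local Notation s := (mpconj f *m C + mpconj h).

Lemma mpconjK p q (A : 'M[maxplus R]_(p, q)) : mpconj (mpconj A) = A.
Proof. by apply/matrixP => i j; rewrite !mxE mpinvK. Qed.

Lemma mul_le1_conj p (r : 'rV[maxplus R]_p) (x : 'cV[maxplus R]_p) :
  (forall j, r 0 j != 0) -> (r *m x) 0 0 <= 1 <-> mxle x (mpconj r).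
Proof.
move=> r0; split=> [rx i j|xr].
  rewrite ord1 mxE -[mpinv _]mulr1 -[leLHS]mul1r -{1}(mpmulV (r0 i)) -mulrA.
  apply: mp_leM => //; apply: le_trans rx; rewrite mxE.
  exact: (mp_le_sum (fun i => r 0 i * x i 0)).
rewrite mxE; apply: mp_sum_le => i _.
apply: le_trans (mp_leM (lexx _) (xr i 0)) _.
by rewrite mxE mulrC mpmulV.
Qed.

Lemma mul_conj_le1 p (a x : 'cV[maxplus R]_p) :
  regular a -> (mpconj a *m x) 0 0 <= 1 <-> mxle x a.
Proof.
move=> a0; rewrite mul_le1_conj ?mpconjK // => j.
by rewrite mxE mpinv_eq0 a0.
Qed.

Hypotheses (hf : regular f) (hh : regular h).

Lemma feasibleP x y : feasible B C D f g h x y <->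
  [/\ regular x, y = C *m x, mxle (M *m x) x, mxle g x & (s *m x) 0 0 <= 1].
Proof.
rewrite !mulmxDl -!mulmxA [addmx _ _ 0 0]mxE mp_leD.
split=> [[x0 [Bx Cx Dy] [gx xh] yf]|[x0 yE /mxleDP[Bx Dx] gx /andP[fx hx]]].
  split; rewrite ?Cx //; first exact/mxleDP.
  by apply/andP; split; apply/mul_conj_le1.
split=> //; rewrite ?yE //.
  by split=> //; apply/mul_conj_le1.
exact/mul_conj_le1.
Qed.

Lemma makespan_leP x y t : regular x ->
  makespan x y <= t <-> forall i, ((ones R n)^T *m y) 0 0 <= t * x i 0.
Proof.
move=> x0; rewrite /makespan -mulmxA mxE big_ord1.
set a := (_ *m y) 0 0.
have -> : (mpconj x *m ones R n) 0 0 = \sum_i mpinv (x i 0).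
  by rewrite mxE; apply: eq_bigr => i _; rewrite !mxE mulr1.
rewrite mulr_suml; split=> [le_t i|le_t].
  rewrite -mpinv_mul_le //; apply: le_trans le_t.
  exact: (mp_le_sum (fun i => mpinv (x i 0) * a)).
by apply: mp_sum_le => i _; rewrite mpinv_mul_le.
Qed.

Lemma rank_one_leP (x : 'cV[maxplus R]_n) t : t != 0 ->
  mxle (rank_one C t *m x) x <->
  forall i, ((ones R n)^T *m (C *m x)) 0 0 <= t * x i 0.
Proof.
move=> t0; rewrite /rank_one -scalemxAl -!mulmxA; split=> le_x i => [|j].
  by have := le_x i 0; rewrite mxE ones_mulE mpinv_mul_le // mulrC.
by rewrite ord1 mxE ones_mulE mpinv_mul_le // mulrC.
Qed.

Lemma colsum_neq0 (hC : column_regular C) j : ((ones R n)^T *m C) 0 j != 0.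
Proof.
have [i Cij] := hC j; apply: mp_neq0_le Cij; rewrite mxE.
apply: le_trans
  (mp_le_sum (fun i => (ones R n)^T 0 i * C i j) (i := i) _) => //.
by rewrite !mxE mul1r.
Qed.

End Problem.

Section Optimum.
Variables (R : realDomainType) (n : nat).
Variables (C M : 'M[maxplus R]_n) (s : 'rV[maxplus R]_n).
Variable g : 'cV[maxplus R]_n.
Local Notation t := (theta C M s g).
Local Notation c := ((ones R n)^T *m C).

Lemma theta_ge_norm k : (k < n)%N -> mpnorm (C *m M ^+ k) <= t.
Proof.
move=> kn; apply: (@le_trans _ _ (mpnorm (C *m kleene M))).
  rewrite !mpnormE; apply: mxleMr; apply: mxleMl; apply: mxleMl.
  exact: mxle_kleene.
by rewrite /theta addrC; apply: mp_leDl.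
Qed.

Lemma theta_ge_term i j : (i + j + 2 <= n)%N ->
  mpnorm (s *m M ^+ i) * mpnorm (C *m M ^+ j *m g) <= t.
Proof.
move=> ijn; apply: le_trans (mp_leDl _ _).
have lin : (i < n)%N by rewrite (leq_trans _ ijn) // addn2 ltnS leqW ?leq_addr.
have ljn : (j < n)%N by rewrite (leq_trans _ ijn) // addn2 ltnS leqW ?leq_addl.
apply: le_trans (mp_le_sum (fun i : 'I_n =>
  \sum_(j < n | (i + j + 2 <= n)%N)
    mpnorm (s *m M ^+ i) * mpnorm (C *m M ^+ j *m g))
  (i := Ordinal lin) _) => //.
exact: (mp_le_sum (fun j : 'I_n =>
  mpnorm (s *m M ^+ i) * mpnorm (C *m M ^+ j *m g)) (i := Ordinal ljn)).
Qed.

Lemma theta_neq0 : (0 < n)%N -> column_regular C -> t != 0.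
Proof.
move=> n0 hC; apply: mp_neq0_le (theta_ge_norm n0) _.
rewrite expr0 mulmx1 mpnormE; apply: mp_neq0_le (colsum_neq0 hC (Ordinal n0)).
rewrite [leRHS]mxE.
apply: le_trans
  (mp_le_sum (fun j => c 0 j * ones R n j 0) (i := Ordinal n0) _) => //.
by rewrite [X in _ * X]mxE mulr1.
Qed.

Lemma theta_le_makespan x : (0 < n)%N -> column_regular C -> regular x ->
  mxle (M *m x) x -> mxle g x -> (s *m x) 0 0 <= 1 -> t <= makespan x (C *m x).
Proof.
move=> n0 hC x0 Mx gx sx; set v := makespan _ _.
have /(makespan_leP _ _ x0) le_v : makespan x (C *m x) <= v by [].
set a := (_ *m _) 0 0 in le_v.
have le_vx : mxle (a *: ones R n) (v *: x).
  by move=> i j; rewrite ord1 [leLHS]mxE [leRHS]mxE mxE mulr1; apply: le_v.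
have le_row (r : 'rV[maxplus R]_n) i :
    (r *m M ^+ i *m ones R n) 0 0 * a <= v * (r *m x) 0 0.
  have -> : (r *m M ^+ i *m ones R n) 0 0 * a =
    (r *m M ^+ i *m (a *: ones R n)) 0 0.
    by rewrite -scalemxAr [RHS]mxE mulrC.
  apply: le_trans (mxleMl _ le_vx _ _) _.
  rewrite -scalemxAr mxE -mulmxA; apply: mp_leM => //.
  by apply: mxleMl; apply: mulX_le.
rewrite mp_leD; apply/andP; split.
  apply: mp_sum_le => i _; apply: mp_sum_le => j _.
  have le_a : mpnorm (C *m M ^+ j *m g) <= a.
    rewrite mpnormE /a.
    rewrite ones1 mulmx1; apply: mxleMl; rewrite -mulmxA; apply: mxleMl.
    by apply: mxle_trans (mulX_le j Mx); apply: mxleMl.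
  apply: le_trans (mp_leM (lexx _) le_a) _; rewrite mpnormE.
  rewrite ones1 trmx1 mul1mx; apply: le_trans (le_row s i) _.
  by rewrite -[leRHS]mulr1 mp_leM.
have a0 : a != 0.
  have ci0 := mp_mul_neq0 (colsum_neq0 hC (Ordinal n0)) (x0 (Ordinal n0)).
  apply: mp_neq0_le ci0; rewrite /a mulmxA [leRHS]mxE.
  exact: (mp_le_sum (fun j => c 0 j * x j 0)).
rewrite mpnormE /kleene mulmx_sumr mulmx_sumr mulmx_suml summxE.
apply: mp_sum_le => k _; rewrite -(mp_leM2r _ _ a0) mulmxA.
by apply: le_trans (le_row c k) _; rewrite /a mulmxA.
Qed.

Lemma mul_solmx_g_le1 : (0 < n)%N -> column_regular C ->
  (s *m kleene M *m g) 0 0 <= 1 -> (s *m solmx C M t *m g) 0 0 <= 1.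
Proof.
move=> n0 hC sKg; have t0 := theta_neq0 n0 hC.
rewrite solmxE mulmxDr mulmxDl [addmx _ _ 0 0]mxE mp_leD sKg andbT.
rewrite !mulmx_sumr !mulmx_suml summxE; apply: mp_sum_le => i _.
rewrite !mulmx_sumr !mulmx_suml summxE; apply: mp_sum_le => j ijn.
rewrite /rank_one -scalemxAr -!scalemxAl -scalemxAr -scalemxAl mxE.
rewrite mpinv_mul_le // mul1r; apply: le_trans (theta_ge_term ijn).
rewrite !mpnormE ones1 trmx1 mul1mx mulmx1.
have -> : s *m (M ^+ i *m (ones R n *m c) *m M ^+ j) *m g =
  (s *m M ^+ i *m ones R n) *m ((ones R n)^T *m (C *m M ^+ j *m g)).
  by rewrite !mulmxA.
by rewrite mxE big_ord1.
Qed.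

(* For n = 1 the double sum in [solmx] is empty, but then u != 0 already says
   that u is regular. *)
Lemma solmx_regular u : (0 < n)%N -> column_regular C -> t != 0 -> u != 0 ->
  regular (solmx C M t *m u).
Proof.
move=> n0 hC t0 u0 i.
have [k uk0] : exists k, u k 0 != 0.
  apply/existsP; apply: contraNT u0; rewrite negb_exists => /forallP u0.
  by apply/eqP/matrixP => k l; rewrite ord1 mxE; apply/eqP;
     have := u0 k; rewrite negbK.
suff Gik : solmx C M t i k != 0.
  apply: mp_neq0_le (mp_mul_neq0 Gik uk0); rewrite [leRHS]mxE.
  exact: (mp_le_sum (fun k => solmx C M t i k * u k 0)).
have [<-|neq_ik] := eqVneq i k.
  by apply: mp_neq0_le (solmx_ge1 C M t n0 i i) _; rewrite mxE eqxx.
have n2 : (1 < n)%N.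
  case: n n0 i k neq_ik {u u0 uk0 t0 hC} => [//|[|//]] _ i k.
  by rewrite !ord1 eqxx.
apply: (@mp_neq0_le _ (rank_one C t i k)); last first.
  by rewrite mxE ones_mulE mp_mul_neq0 ?mpinv_eq0 ?colsum_neq0.
rewrite solmxE; apply: (@le_trans _ _ _ _ _ _ (mxleDl _ _ i k)).
have := mxle_sum2 (P := fun (i j : 'I_n) => (i + j + 2 <= n)%N)
  (fun i j : 'I_n => M ^+ i *m rank_one C t *m M ^+ j)
  (i := Ordinal n0) (j := Ordinal n0) n2 i k.
by rewrite /= !expr0 mulmx1 mul1mx.
Qed.

End Optimum.

Theorem theorem4 (R : realType) (n : nat) (hn : (0 < n)%N)
    (B C D : 'M[maxplus R]_n) (f g h : 'cV[maxplus R]_n)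
    (hC : column_regular C) (hf : regular f) (hh : regular h) :
  let M : 'M[maxplus R]_n := B + D *m C in
  let s : 'rV[maxplus R]_n := mpconj f *m C + mpconj h in
  mpTr M <= 1 ->
  (s *m kleene M *m g) ord0 ord0 <= 1 ->
  let t := theta C M s g in
  let G := solmx C M t in
  [/\ exists x y, feasible B C D f g h x y /\ makespan x y = t,
      forall x y, feasible B C D f g h x y -> t <= makespan x y
    & forall x y,
        (feasible B C D f g h x y /\ makespan x y = t) <->
        (exists u : 'cV[maxplus R]_n,
          [/\ u != 0, mxle g u, mxle u (mpconj (s *m G)),
              x = G *m u & y = C *m G *m u])].
Proof.
move=> M s TrM sKg t G.
have t0 : t != 0 by exact: theta_neq0.
have lower x y : feasible B C D f g h x y -> t <= makespan x y.
  by move=> /(feasibleP _ _ _ _ hf hh)[x0 -> Mx gx sx];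
     apply: theta_le_makespan.
have G1 : mxle 1%:M G by exact: solmx_ge1.
have s0 j : s 0 j != 0.
  have : mpconj h 0 j != 0 by rewrite mxE mpinv_eq0 hh.
  exact/mp_neq0_le/mxleDr.
have sG0 j : (s *m G) 0 j != 0.
  apply: mp_neq0_le (s0 j).
  by have := mxleMl s G1; rewrite mulmx1; apply.
have QG : mxle ((rank_one C t + M) *m G) G.
  by apply: perturb_mul_solmx => // k; apply: theta_ge_norm.
have main x y : (feasible B C D f g h x y /\ makespan x y = t) <->
  (exists u : 'cV[maxplus R]_n,
    [/\ u != 0, mxle g u, mxle u (mpconj (s *m G)),
        x = G *m u & y = C *m G *m u]).
  split=> [[fxy mk]|[u [u0 gu /(mul_le1_conj _ sG0) sGu -> ->]]].
    have [x0 yE Mx gx sx] := (feasibleP _ _ _ _ hf hh _ _).1 fxy.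
    have Px : mxle (rank_one C t *m x) x.
      apply/rank_one_leP => //; rewrite -yE; apply/makespan_leP => //.
      by rewrite mk.
    have Gx : G *m x = x.
      apply: mxle_anti; first exact: solmx_mul_le.
      by have := mxleMr x G1; rewrite mul1mx.
    exists x; rewrite -mulmxA Gx; split=> //.
      apply: contraTneq (x0 (Ordinal hn)) => ->.
      by rewrite mxE eqxx.
    by apply/mul_le1_conj => //; rewrite -mulmxA Gx.
  have QGu : mxle ((rank_one C t + M) *m (G *m u)) (G *m u).
    by rewrite mulmxA; apply: mxleMr.
  move: QGu; rewrite mulmxDl => /mxleDP[PGu MGu].
  have reg : regular (G *m u) by exact: solmx_regular.
  have feas : feasible B C D f g h (G *m u) (C *m G *m u).
    apply/feasibleP => //; split; rewrite ?mulmxA // -?mulmxA //.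
    apply: mxle_trans gu _.
    by have := mxleMr u G1; rewrite mul1mx.
  split=> //; apply/le_anti; rewrite lower // andbT.
  apply/makespan_leP => //; rewrite -mulmxA.
  exact/rank_one_leP.
split=> //.
pose u := mpconj (s *m G).
have u0 : u != 0.
  apply/eqP => /matrixP/(_ (Ordinal hn) 0)/eqP.
  by rewrite !mxE mpinv_eq0 -[_ == _]negbK;
     have := sG0 (Ordinal hn); rewrite mxE => ->.
exists (G *m u), (C *m G *m u); apply/main; exists u; split=> //.
by apply/mul_le1_conj => //; apply: mul_solmx_g_le1.
Qed.
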